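(* There is an absolute constant $C>0$ such that for every finite Abelian group $G$: (i) there is a deterministic query algorithm which, for every finite set $X$ and every $f:G\to X$ hiding a subgroup $H\le G$, correctly decides whether $H$ is trivial using at most $C\sqrt{|G|/|H|}$ queries; (ii) there is a deterministic query algorithm which, for every finite set $X$ and every $f:G\to X$ hiding a subgroup $H\le G$, outputs $H$ using at most $C\left(\sqrt{\frac{|G|}{|H|}\max\{1,\log_2|H|\}}+\log_2|H|\right)$ queries. (The algorithms have no prior information about $H$.)
   Context: Hidden subgroup problem ($\mathsf{HSP}$): $G$ is a finite group (known to the algorithm, here given as a direct product of cyclic groups of prime-power order), $X$ a finite set, and $f:G\to X$ is an unknown function with the promise that there is a subgroup $H\le G$ such that for all $g_1,g_2\in G$, $f(g_1)=f(g_2)$ iff $g_1H=g_2H$; we say $f$ hides $H$. The identification version asks to output $H$; the decision version asks whether $H$ is trivial. A deterministic query algorithm accesses $f$ only by adaptively choosing elements $g\in G$ and receiving $f(g)$ (a query); its query complexity on $f$ is the number of queries made. *)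

(* Defs.v *)
From Stdlib Require Import Reals.
From mathcomp Require Import all_boot all_fingroup.
Set Implicit Arguments. Unset Strict Implicit. Unset Printing Implicit Defensive.

Inductive qstep (gT : Type) (O : Type) : Type :=
| Query of gT
| Output of O.
Arguments Query {gT O} _.
Arguments Output {gT O} _.

(** A deterministic algorithm is a strategy mapping the transcript so far to the
    next step.  A transcript is the list of (queried element, answer label), where
    the answer to the i-th query is encoded as the index of the first earlier (or
    current) query with the same oracle value.  This is exactly the information a
    deterministic algorithm that must work uniformly for every finite set X can
    use about the oracle answers (it can only compare them for equality). *)
Definition algorithm (gT : Type) (O : Type) := seq (gT * nat) -> qstep gT O.

Fixpoint run_from (gT : Type) (O : Type) (X : eqType) (A : algorithm gT O)
    (f : gT -> X) (fuel : nat) (hist : seq (gT * nat)) : option (O * nat) :=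
  match fuel with
  | 0 => None
  | k.+1 =>
    match A hist with
    | Output o => Some (o, size hist)
    | Query g =>
        let lbl := index (f g) (map (fun p => f p.1) (rcons hist (g, 0))) in
        run_from A f k (rcons hist (g, lbl))
    end
  end.

Definition runs_to (gT : Type) (O : Type) (X : eqType) (A : algorithm gT O)
    (f : gT -> X) (o : O) (q : nat) : Prop :=
  exists fuel, run_from A f fuel [::] = Some (o, q).

Definition hides (gT : finGroupType) (X : Type) (f : gT -> X) (H : {group gT}) : Prop :=
  forall g1 g2 : gT, f g1 = f g2 <-> (g1 *: (H : {set gT}))%g = (g2 *: (H : {set gT}))%g.

Local Open Scope R_scope.
Definition log2R (n : nat) : R := (ln (INR n) / ln 2)%R.

Definition decision_bound (C : R) (g h : nat) : R :=
  (C * sqrt (INR g / INR h))%R.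

Definition identification_bound (C : R) (g h : nat) : R :=
  (C * (sqrt (INR g / INR h * Rmax 1 (log2R h)) + log2R h))%R.

(* Main.v *)
Require Import Defs.
From Stdlib Require Import Reals Lra Arith.
From mathcomp Require Import all_boot all_fingroup.
From mathcomp Require pgroup.

(** Fix a chain of subgroups of [G] with steps of prime index and climb it.  When
    going from [K] to [K'], with [x] in [K' \ K], either [K' :&: H \subset K] or
    [H] meets the coset [x K] (a pivot).  The non-pivot steps [(x_j, p_j)] so far
    provide mixed-radix representatives [\prod_j x_j ^ c_j], [c_j < p_j], of [K]
    modulo [K :&: H]; their number [n] is at most [|K| / |K :&: H|].  To detect a
    pivot, write each representative as baby step times giant step, query the
    baby steps [b] and the elements [(x g)^-1] with [g] a giant step, and look for
    a collision.

    The baby steps are an initial segment of the representatives, so they are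
    nested along the climb and only the final set counts; the giant steps are new
    at each step.  After [k] pivots the initial segment has length about
    [sqrt ((k + 1) n)], leaving [1 + O (sqrt (n / (k + 1)))] giant steps.  Summed
    over the pivots ([k <= log2 |H|]) this is [O (k + sqrt (k n))], and over the
    non-pivot steps, each of which at least doubles [n], it is geometric.  For the
    decision problem stop at the first pivot. *)

Set Implicit Arguments. Unset Strict Implicit. Unset Printing Implicit Defensive.

(** * Decision trees as query algorithms *)

Section DecisionTrees.
Variables (gT : finGroupType) (O : Type).

Inductive tree : Type :=
| Leaf of O
| Node of gT & (nat -> tree).

Fixpoint tree_alg (t : tree) (hist : seq (gT * nat)) : qstep gT O :=
  match t, hist with
  | Leaf o, _ => Output o
  | Node g _, [::] => Query g
  | Node _ k, (_, l) :: hist' => tree_alg (k l) hist'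
  end.

Section Oracle.
Variables (X : eqType) (f : gT -> X).

(** Labels are taken in the whole list, whereas [run_from] stops at the current query; both agree
    because [index] finds the first occurrence. *)
Definition transcript (qs : seq gT) : seq (gT * nat) :=
  [seq (g, index (f g) (map f qs)) | g <- qs].

Lemma transcript_rcons qs g :
  transcript (rcons qs g) =
  rcons (transcript qs) (g, index (f g) (map f (rcons qs g))).
Proof.
rewrite /transcript map_rcons; congr rcons; apply/eq_in_map => y yqs.
by rewrite map_rcons -cats1 index_cat map_f.
Qed.

Lemma map_fst_transcript qs : map fst (transcript qs) = qs.
Proof. by rewrite -map_comp map_id. Qed.

Fixpoint eval (t : tree) (qs : seq gT) : O * seq gT :=
  match t with
  | Leaf o => (o, qs)
  | Node g k => eval (k (index (f g) (map f (rcons qs g)))) (rcons qs g)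
  end.

(** [A] stays fixed while the induction descends in [t], so the hypothesis only asks that [A] act as
    [t] beyond the transcript. *)
Lemma run_from_tree_alg (A : algorithm gT O) t qs :
    (forall h, A (transcript qs ++ h) = tree_alg t h) ->
  exists fuel, run_from A f fuel (transcript qs) =
               Some ((eval t qs).1, size (eval t qs).2).
Proof.
elim: t qs => [o | g k IHk] qs eqA /=.
  exists 1 => /=; rewrite -[transcript qs]cats0 eqA /=.
  by rewrite cats0 size_map.
have Ag : A (transcript qs) = Query g by rewrite -[transcript qs]cats0 eqA.
set l := index _ _.
have [|fuel run] := IHk l (rcons qs g).
  by move=> h; rewrite transcript_rcons cat_rcons eqA.
exists fuel.+1; rewrite /= Ag -run transcript_rcons /l.
do 3 f_equal.
by rewrite !map_rcons -map_comp.
Qed.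

Lemma runs_to_tree_alg t :
  runs_to (tree_alg t) f (eval t [::]).1 (size (eval t [::]).2).
Proof. exact: (@run_from_tree_alg _ t [::]). Qed.

End Oracle.

Fixpoint ask (s : seq gT) (k : seq (gT * nat) -> tree) hist : tree :=
  if s is g :: s' then Node g (fun l => ask s' k (rcons hist (g, l)))
  else k hist.

Lemma eval_ask (X : eqType) (f : gT -> X) s k qs :
  eval f (ask s k (transcript f qs)) qs =
  eval f (k (transcript f (qs ++ s))) (qs ++ s).
Proof.
elim: s qs => [|g s IHs] qs /=; first by rewrite cats0.
by rewrite -transcript_rcons IHs cat_rcons.
Qed.

(** Repeated elements are skipped so that query lists stay duplicate-free and any list containing
    them bounds their number. *)
Definition ask_new (s : seq gT) (k : seq (gT * nat) -> tree) hist : tree :=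
  ask [seq g <- undup s | g \notin map fst hist] k hist.

Lemma eval_ask_new (X : eqType) (f : gT -> X) s k qs : uniq qs ->
  exists qs', [/\ uniq qs', qs' =i qs ++ s &
    eval f (ask_new s k (transcript f qs)) qs =
    eval f (k (transcript f qs')) qs'].
Proof.
move=> uqs; exists (qs ++ [seq g <- undup s | g \notin qs]); split.
- rewrite cat_uniq uqs filter_uniq ?undup_uniq // andbT.
  by apply/hasPn => g; rewrite mem_filter => /andP[].
- move=> g; rewrite !mem_cat mem_filter mem_undup.
  by case: (g \in qs).
- by rewrite /ask_new eval_ask map_fst_transcript.
Qed.

End DecisionTrees.
Arguments Leaf {gT O} _.

(** * The subgroup generated by observed collisions *)

Section Known.
Variable gT : finGroupType.
Implicit Types (H : {group gT}) (hist : seq (gT * nat)).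
Local Open Scope group_scope.

(** Computable from the labels alone: two queries with equal labels differ by an element of the
    hidden subgroup. *)
Definition known hist : {group gT} :=
  generated_group
    [set d | has (fun p => has (fun q => (p.2 == q.2) && (d == p.1^-1 * q.1))
                               hist) hist].

Lemma hidesE (X : Type) (f : gT -> X) H : hides f H ->
  forall g1 g2, f g1 = f g2 <-> g1^-1 * g2 \in H.
Proof.
move=> hf g1 g2; rewrite hf -mem_lcoset; split=> [-> | /lcoset_eqP //].
exact: lcoset_refl.
Qed.

Lemma eq_label (X : eqType) (f : gT -> X) qs g g' : g \in qs -> g' \in qs ->
  index (f g) (map f qs) = index (f g') (map f qs) -> f g = f g'.
Proof.
by move=> gqs g'qs e; rewrite -(nth_index (f g) (map_f f gqs)) e nth_index ?map_f.
Qed.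

Lemma known_sub (X : eqType) (f : gT -> X) H qs : hides f H ->
  known (transcript f qs) \subset H.
Proof.
move=> /hidesE hf; rewrite gen_subG; apply/subsetP => d; rewrite inE.
case/hasP=> _ /mapP[g gqs ->] /hasP[_ /mapP[g' g'qs ->]] /= /andP[/eqP e /eqP->].
exact/hf/eq_label/e.
Qed.

Lemma mem_known (X : eqType) (f : gT -> X) qs g g' :
  g \in qs -> g' \in qs -> f g = f g' -> g^-1 * g' \in known (transcript f qs).
Proof.
move=> gqs g'qs e; apply: mem_gen; rewrite inE.
apply/hasP; exists (g, index (f g) (map f qs)); first exact: map_f.
apply/hasP; exists (g', index (f g') (map f qs)).
  exact: (map_f (fun z => (z, index (f z) (map f qs)))).
by rewrite /= e !eqxx.
Qed.

End Known.

(** * Mixed-radix representatives, baby steps and giant steps *)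

Section MixedRadix.
Variable gT : finGroupType.
Hypothesis cG : abelian [set: gT].
Implicit Types (w : seq (gT * nat)) (x : gT) (a p : nat).
Local Open Scope group_scope.

Lemma mulgC_abelian (x y : gT) : x * y = y * x.
Proof. by apply: (centsP cG); rewrite inE. Qed.

Definition powers x n := [seq x ^+ c | c <- iota 0 n].

Lemma mem_powers x n c : (c < n)%N -> x ^+ c \in powers x n.
Proof. by move=> cn; apply: map_f; rewrite mem_iota. Qed.

Lemma size_powers x n : size (powers x n) = n.
Proof. by rewrite size_map size_iota. Qed.

Fixpoint digits w : seq gT :=
  if w is (x, p) :: w' then [seq y * r | y <- powers x p, r <- digits w']
  else [:: 1].

(** An initial segment in mixed-radix order, the head of [w] being least significant: digits are
    free while their radices fit into [a], the next one is truncated, the rest are zero. *)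
Fixpoint baby w a : seq gT :=
  if w is (x, p) :: w' then
    if (p <= a)%N then [seq y * r | y <- powers x p, r <- baby w' (a %/ p)]
    else powers x a
  else [:: 1].

(** Complement of [baby]: the lowest digits are zero, the truncated one runs through multiples of
    [a], the higher ones are free; the [+ 1] covers a last incomplete block. *)
Fixpoint giant w a : seq gT :=
  if w is (x, p) :: w' then
    if (p <= a)%N then giant w' (a %/ p)
    else [seq y * r | y <- powers (x ^+ a) (p %/ a + 1), r <- digits w']
  else [:: 1].

Definition radix w := (\prod_(d <- w) d.2)%N.

Definition positive_radices w := all (fun d : gT * nat => (0 < d.2)%N) w.

Lemma radix_gt0 w : positive_radices w -> (0 < radix w)%N.
Proof.
rewrite /radix; elim: w => [|[x p] w IHw] /=; first by rewrite big_nil.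
by case/andP=> p0 /IHw w0; rewrite big_cons muln_gt0 p0.
Qed.

Lemma size_digits w : size (digits w) = radix w.
Proof.
rewrite /radix; elim: w => [|[x p] w IHw] /=; first by rewrite big_nil.
by rewrite size_allpairs IHw size_powers big_cons.
Qed.

Lemma digits_rcons w x p r c : r \in digits w -> (c < p)%N ->
  r * x ^+ c \in digits (rcons w (x, p)).
Proof.
move=> rw cp; elim: w r rw => [|[y q] w IHw] r.
  rewrite inE => /eqP->; rewrite mul1g -[x ^+ c]mulg1.
  by apply: (allpairs_f (fun y r => y * r)); rewrite ?mem_powers ?inE.
case/allpairsP=> -[u v] [/= uP vw ->]; rewrite -mulgA.
by apply: allpairs_f => //; apply: IHw.
Qed.

Lemma size_baby w a : (0 < a)%N -> (size (baby w a) <= a)%N.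
Proof.
elim: w a => [|[x p] w IHw] a a0 //=.
case: (leqP p a) => [pa | _]; last by rewrite size_powers.
rewrite size_allpairs size_powers.
case: p pa => [//|p pa].
apply: leq_trans (leq_divM a p.+1); rewrite mulnC leq_mul2r IHw ?orbT //.
by rewrite divn_gt0.
Qed.

Lemma baby1 w a : positive_radices w -> (0 < a)%N -> 1 \in baby w a.
Proof.
elim: w a => [|[x p] w IHw] a //=; first by rewrite inE.
case/andP=> /= p0 w0 a0; case: (leqP p a) => [pa | _]; last first.
  by rewrite -(expg0 x) mem_powers.
rewrite -[1]mulg1 allpairs_f //; first by rewrite -(expg0 x) mem_powers.
by rewrite IHw ?divn_gt0.
Qed.

(** Lets old baby steps be reused. When [a'] reaches [p] but [a] does not, a truncated digit becomes
    a free one followed by zeros, which [baby1] supplies. *)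
Lemma baby_mono w w' a a' :
    positive_radices (w ++ w') -> (0 < a <= a')%N ->
  {subset baby w a <= baby (w ++ w') a'}.
Proof.
elim: w a a' => [|[x p] w IHw] a a' /= => [pos /andP[a0 aa'] y | ].
  by rewrite inE => /eqP->; apply: baby1 => //; apply: leq_trans aa'.
case/andP=> p0 pos /andP[a0 aa'] y.
have a'0 := leq_trans a0 aa'.
case: (leqP p a) => [pa | ap].
  rewrite (leq_trans pa aa') => /allpairsP[[u v] [/= uP vw ->]].
  apply: allpairs_f => //; apply: IHw vw => //.
  by rewrite divn_gt0 // pa leq_div2r.
case/mapP=> c; rewrite mem_iota /= add0n => ca ->.
case: (leqP p a') => [pa' | _]; last by rewrite mem_powers // (leq_trans ca).
rewrite -[_ ^+ c]mulg1 allpairs_f ?mem_powers ?(ltn_trans ca) //.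
by rewrite baby1 ?divn_gt0.
Qed.

Lemma digits_baby_giant w a r : positive_radices w -> (0 < a)%N ->
    r \in digits w ->
  exists b g, [/\ b \in baby w a, g \in giant w a & r = b * g].
Proof.
elim: w a r => [|[x p] w IHw] a r /=.
  by rewrite inE => _ _ /eqP->; exists 1, 1; rewrite mulg1 inE.
case/andP=> p0 pos a0 /allpairsP[[u v] [/= uP vw ->]].
case: (leqP p a) => [pa | ap].
  have [|b [g [bw gw ->]]] := IHw (a %/ p) v pos _ vw; first by rewrite divn_gt0.
  by exists (u * b), g; rewrite mulgA allpairs_f.
case/mapP: uP => c; rewrite mem_iota add0n /= => cp ->.
exists (x ^+ (c %% a)), ((x ^+ a) ^+ (c %/ a) * v).
split; first by rewrite mem_powers ?ltn_mod.
  by apply: allpairs_f => //; rewrite mem_powers // addn1 ltnS leq_div2r // ltnW.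
rewrite mulgA -expgM -expgD; congr (x ^+ _ * _).
by rewrite addnC mulnC -divn_eq.
Qed.

(* With [a + 1] instead of [a] the bound survives the floors [a %/ p]. *)
Lemma size_giant w a : positive_radices w -> (0 < a)%N ->
  size (giant w a) = 1%N \/ (size (giant w a) * a.+1 <= 4 * radix w)%N.
Proof.
rewrite /radix; elim: w a => [|[x p] w IHw] a /=; first by left.
case/andP=> p0 pos a0; rewrite big_cons /=.
case: (leqP p a) => [pa | ap].
  have [|->|le4] := IHw (a %/ p) pos; [by rewrite divn_gt0 | by left | right].
  rewrite mulnCA; apply: leq_trans (leq_mul (leqnn p) le4).
  by rewrite mulnCA leq_mul2l mulnC ltn_ceil ?orbT.
right; rewrite size_allpairs size_digits size_powers addn1 -/(radix w).
rewrite mulnAC mulnA leq_mul2r; apply/orP; right.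
(* [q * a <= p] and [a < p] give [q.+1 * a <= 2 p]; [a.+1 <= 2 a] brings the other factor 2 of the
   4. *)
have := leq_divM p a; set q := (_ %/ _)%N => qa.
apply: (@leq_trans (q.+1 * (a + a))).
  by rewrite leq_mul2l -[a.+1]addn1 leq_add2l a0 orbT.
have le2 : (q.+1 * a <= p + p)%N by rewrite mulSn leq_add // ltnW.
by rewrite mulnDr -[4]/(2 + 2)%N mulnDl !mul2n -!addnn leq_add.
Qed.

End MixedRadix.

(** * Amortised query count *)

Section Cost.
Local Open Scope R_scope.

Definition window (k n : nat) : nat := Nat.sqrt (k.+1 * n).

(** A potential bounding the giant steps queried so far: [INR k] pays for pivot stages with a single
    giant step, and 13 is large enough because 13 * 2/5 > 4 in both stage lemmas below. *)
Definition giant_cost (k n : nat) : R := INR k + 13 * sqrt (INR (k.+1 * n)).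

(** 14 is 13 plus 1 for the at most [window k n] baby steps. *)
Definition query_cost (k n : nat) : R := INR k + 14 * sqrt (INR (k.+1 * n)).

Lemma INR_le (m n : nat) : (m <= n)%N -> INR m <= INR n.
Proof. by move/leP; apply: le_INR. Qed.

Lemma INR_muln (m n : nat) : INR (m * n)%N = INR m * INR n.
Proof. by rewrite -mult_INR. Qed.

Lemma INR_ge1 (n : nat) : (0 < n)%N -> 1 <= INR n.
Proof. exact: (@INR_le 1). Qed.

Lemma window_le k n : INR (window k n) <= sqrt (INR (k.+1 * n)).
Proof.
have [le _] := Nat.sqrt_spec (k.+1 * n)%N (Nat.le_0_l _).
rewrite -[INR (window k n)]sqrt_square; last exact: pos_INR.
apply: sqrt_le_1_alt; rewrite -mult_INR; exact: le_INR.
Qed.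

Lemma lt_window k n : sqrt (INR (k.+1 * n)) <= INR (window k n).+1.
Proof.
have [_ lt] := Nat.sqrt_spec (k.+1 * n)%N (Nat.le_0_l _).
rewrite -[INR (window k n).+1]sqrt_square; last exact: pos_INR.
apply: sqrt_le_1_alt; rewrite -mult_INR; apply: le_INR; exact: Nat.lt_le_incl.
Qed.

Lemma window_mono k n k' n' : (k <= k')%N -> (n <= n')%N ->
  (window k n <= window k' n')%N.
Proof.
by move=> kk' nn'; apply/leP; apply: Nat.sqrt_le_mono; apply/leP; apply: leq_mul.
Qed.

Lemma window_gt0 k n : (0 < n)%N -> (0 < window k n)%N.
Proof.
move=> n0; apply: (@leq_trans (window 0 1)) => //; exact: window_mono.
Qed.

Lemma sqrt_INR_mul m n : sqrt (INR (m * n)) = sqrt (INR m) * sqrt (INR n).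
Proof. by rewrite INR_muln sqrt_mult //; apply: pos_INR. Qed.

Lemma sqrt_INR_ge1 n : (0 < n)%N -> 1 <= sqrt (INR n).
Proof. by move=> n0; rewrite -sqrt_1; apply: sqrt_le_1_alt; apply: INR_ge1. Qed.

Definition giant_bound (k n b : nat) : Prop :=
  b = 1%N \/ (b * (window k n).+1 <= 4 * n)%N.

Lemma giant_boundE k n b : (0 < n)%N -> giant_bound k n b ->
  INR b = 1 \/ INR b * sqrt (INR k.+1) <= 4 * sqrt (INR n).
Proof.
move=> n0 [-> | le4]; [by left | right].
have := lt_window k n; rewrite sqrt_INR_mul => lt.
have v1 := sqrt_INR_ge1 n0.
have vv : sqrt (INR n) * sqrt (INR n) = INR n by rewrite sqrt_sqrt //; apply: pos_INR.
move/INR_le: le4; rewrite !INR_muln (_ : INR 4 = 4); last by rewrite INR_IZR_INZ.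
have := Rmult_le_compat_l _ _ _ (pos_INR b) lt.
set u := sqrt (INR k.+1) in lt *; set v := sqrt (INR n) in v1 lt vv *.
move=> h1 h2; apply: (Rmult_le_reg_r v); [lra | lra].
Qed.

Lemma giant_cost_pivot k n b : (0 < n)%N -> giant_bound k n b ->
  giant_cost k n + INR b <= giant_cost k.+1 n.
Proof.
move=> n0 /(giant_boundE n0); rewrite /giant_cost !sqrt_INR_mul.
have v1 := sqrt_INR_ge1 n0.
have u1 : 1 <= sqrt (INR k.+1) by apply: sqrt_INR_ge1.
have u2 : 1 <= sqrt (INR k.+2) by apply: sqrt_INR_ge1.
have uu : sqrt (INR k.+1) * sqrt (INR k.+1) = INR k.+1.
  by rewrite sqrt_sqrt //; apply: pos_INR.
have uu2 : sqrt (INR k.+2) * sqrt (INR k.+2) = INR k.+1 + 1.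
  by rewrite sqrt_sqrt -?S_INR //; apply: pos_INR.
have kS := S_INR k.
move: (sqrt (INR k.+1)) (sqrt (INR k.+2)) (sqrt (INR n)) (INR b) v1 u1 u2 uu uu2.
move=> u u' v B v1 u1 u2 uu uu2 hB.
have uu' : u <= u' by nra.
case: hB => hB; first by rewrite hB; nra.
(* [u (u' - u) = u / (u' + u)] as the squares differ by 1, and this is at least 2/5 once
   [u' <= 3/2 u]. *)
have gap : 4 <= 13 * (u * (u' - u)).
  have : u' <= 3 / 2 * u.
    apply: Rnot_lt_le => lt.
    have : (3 / 2 * u) * (3 / 2 * u) < u' * u' by apply: Rmult_le_0_lt_compat; lra.
    nra.
  nra.
suff : B <= 13 * (u' - u) * v by lra.
apply: (Rmult_le_reg_r u); first by lra.
nra.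
Qed.

Lemma giant_cost_radix k n p b : (0 < n)%N -> (1 < p)%N -> giant_bound k n b ->
  giant_cost k n + INR b <= giant_cost k (n * p).
Proof.
move=> n0 p2 /(giant_boundE n0); rewrite /giant_cost !sqrt_INR_mul.
have v1 := sqrt_INR_ge1 n0.
have u1 : 1 <= sqrt (INR k.+1) by apply: sqrt_INR_ge1.
(* 7/5 is below the root of 2, so the root term gains at least 13 * 2/5 times [u v], more than the
   [4 u v] needed. *)
have q0 : (7 / 5) <= sqrt (INR p).
  rewrite -[(7 / 5)]sqrt_square; last by lra.
  apply: sqrt_le_1_alt; have := INR_le p2; rewrite INR_IZR_INZ /=; lra.
move: (sqrt (INR k.+1)) (sqrt (INR p)) (sqrt (INR n)) (INR b) v1 u1 q0.
move=> u q v B v1 u1 q0 hB.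
have hB' : B <= 4 * (u * v).
  case: hB => hB; first by rewrite hB; nra.
  case: (Rle_dec B 0) => B0; nra.
have : u * v * (7 / 5) <= u * v * q by apply: Rmult_le_compat_l; nra.
nra.
Qed.

Lemma giant_cost_ge0 k n : 0 <= giant_cost k n.
Proof.
rewrite /giant_cost; have := pos_INR k; have := sqrt_pos (INR (k.+1 * n)); lra.
Qed.

Lemma exp2_log2R k m : (2 ^ k <= m)%N -> INR k <= log2R m.
Proof.
move=> km; have ln2 : 0 < ln 2 by rewrite -ln_1; apply: ln_increasing; lra.
have pow2 : INR (2 ^ k) = 2 ^ k.
  by elim: k {km} => [|k IHk] //; rewrite expnS INR_muln IHk.
have pos : 0 < 2 ^ k by apply: pow_lt; lra.
apply: (Rmult_le_reg_r (ln 2)) => //.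
rewrite /log2R /Rdiv Rmult_assoc Rinv_l; last by lra.
rewrite Rmult_1_r -ln_pow; last by lra.
have := INR_le km; rewrite pow2 => -[lt | ->]; last by lra.
by left; apply: ln_increasing.
Qed.

Lemma sqrt_mult_le c u v : 0 <= c -> 0 <= v -> u <= c * c * v ->
  sqrt u <= c * sqrt v.
Proof.
move=> c0 v0 uv; rewrite -[X in X * sqrt v](sqrt_square c) //.
rewrite -sqrt_mult //; first exact: sqrt_le_1_alt.
exact: Rmult_le_pos.
Qed.

Lemma query_cost_decision k n g h : (k <= 1)%N -> (0 < n)%N ->
  INR n <= INR g / INR h -> query_cost k n <= decision_bound 30 g h.
Proof.
move=> k1 n0 ngh; rewrite /query_cost /decision_bound.
have n1 := INR_ge1 n0.
have k1R : INR k <= 1 by apply: INR_le k1.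
have := pos_INR k => k0.
have : 1 <= sqrt (INR g / INR h) by rewrite -sqrt_1; apply: sqrt_le_1_alt; lra.
(* As [k.+1 <= 2], the total is at most 1 + 14 * 2 = 29 times the root. *)
have : sqrt (INR (k.+1 * n)) <= 2 * sqrt (INR g / INR h).
  by apply: sqrt_mult_le; rewrite ?INR_muln ?S_INR; nra.
lra.
Qed.

Lemma query_cost_identification k n g h : (2 ^ k <= h)%N -> (0 < n)%N ->
  INR n <= INR g / INR h -> query_cost k n <= identification_bound 30 g h.
Proof.
move=> kh n0 ngh; rewrite /query_cost /identification_bound.
have n1 := INR_ge1 n0; have kl := exp2_log2R kh; have k0 := pos_INR k.
have := Rmax_l 1 (log2R h); have := Rmax_r 1 (log2R h).
set M := Rmax _ _ => lM M1.
(* [k + 1 <= 2 M], so the root term is at most 14 * 2 = 28 times the new root, and [INR k] is at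
   most [log2R h]. *)
have : sqrt (INR (k.+1 * n)) <= 2 * sqrt (INR g / INR h * M).
  apply: sqrt_mult_le; rewrite ?INR_muln ?S_INR; nra.
have := sqrt_pos (INR g / INR h * M).
lra.
Qed.

End Cost.

(** * Climbing the chain of subgroups *)

Section Search.
Variable gT : finGroupType.
Hypothesis cG : abelian [set: gT].
Implicit Types (K H L : {group gT}) (x : gT).
Local Open Scope group_scope.

Definition chain_step K K' x : Prop :=
  [/\ K \subset K', prime #|K' : K|, x \in K' :\: K &
      forall y, y \in K' -> exists z c,
        [/\ z \in K, (c < #|K' : K|)%N & y = z * x ^+ c]].

Lemma abelian_norm K y : y \in 'N(K).
Proof.
have /normal_norm/subsetP nK : K <| [set: gT].
  by rewrite -sub_abelian_normal ?subsetT.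
by apply: nK; rewrite inE.
Qed.

(** Cauchy's theorem in the quotient by [K] gives an element of prime order; [x] lifts it and [K']
    is the preimage of its cycle. *)
Lemma chain_stepP K : K != [set: gT] :> {set gT} -> exists K' x, chain_step K K' x.
Proof.
move=> KnT; have nK := @abelian_norm K.
have GK1 : (1 < #|([set: gT] / K)%g|)%N.
  rewrite card_quotient; last by apply/subsetP => y _.
  by rewrite indexg_gt1 -[_ \subset _]andTb -(subsetT K) -eqEsubset.
have [xb xbG oxb] := pgroup.Cauchy (pdiv_prime GK1) (pdiv_dvd _).
have pr := pdiv_prime GK1; rewrite -oxb in pr.
pose K' := (coset K @*^-1 <[xb]>)%G.
have iK' : #|K' : K| = #[xb].
  by rewrite -divgS ?sub_cosetpre //= card_cosetpre mulKn ?cardG_gt0.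
have [x _ xbE] := cosetP xb.
exists K', x; split; rewrite ?iK' ?sub_cosetpre //.
  rewrite inE mem_morphpre ?nK /= -?xbE ?cycle_id // ?andbT.
  apply: contraTN pr => /coset_id xb1.
  by rewrite xbE xb1 order1.
move=> y /morphpreP[_ /cyclePmin[c cxb yE]].
exists (y * x ^- c), c; split; rewrite ?mulgKV //.
apply: coset_idr; rewrite ?nK // morphM ?nK // morphV ?nK // morphX ?nK //.
by rewrite yE xbE mulgV.
Qed.

(** [K L] lies between [K] and [K'], and a prime index leaves no room strictly between. *)
Lemma prime_index_mulg K K' L : K \subset K' -> prime #|K' : K| ->
  L \subset K' -> ~~ (L \subset K) -> K * L = K'.
Proof.
move=> KK' pr LK' LnK.
have KLE : K <*> L = K * L.
  by rewrite norm_joinEr //; apply/subsetP => y _; apply: abelian_norm.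
have KLK' : K <*> L \subset K' by rewrite join_subG KK'.
have := Lagrange_index KLK' (joing_subl K L).
have : (1 < #|K <*> L : K|)%N.
  by rewrite indexg_gt1 join_subG subxx.
rewrite -KLE => i1 iM; apply/eqP; rewrite eqEsubset KLK' -indexg_eq1 /=.
have /primeP[_ /(_ #|K <*> L : K|)] := pr.
rewrite -iM dvdn_mull // => /(_ isT) /orP[/eqP e | /eqP e].
  by rewrite e in i1.
by rewrite -(eqn_pmul2r (ltnW i1)) mul1n -e.
Qed.

(* [k] counts the pivots met while climbing to [K], [w] lists the other steps. *)
Record progress (X : eqType) (f : gT -> X) H K w (k : nat) (qs : seq gT) : Prop := {
  progress_radices : positive_radices w;
  progress_cover : forall y, y \in K -> exists r l,
    [/\ r \in digits w, l \in K :&: H & y = r * l];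
  progress_radix : (radix w * #|K :&: H| <= #|K|)%N;
  progress_pivots : (2 ^ k <= #|K :&: H|)%N;
  progress_known : K :&: H \subset known (transcript f qs);
  progress_uniq : uniq qs;
  progress_cost : exists2 S : seq gT,
    {subset qs <= baby w (window k (radix w)) ++ S} &
    Rle (INR (size S)) (giant_cost k (radix w))
}.

(** With inverses, a collision of [b] and [(x g)^-1] tests whether the product [x g b] is in the
    hidden subgroup. *)
Definition stage_queries w k x :=
  let a := window k (radix w) in
  baby w a ++ [seq (x * b)^-1 | b <- giant w a].

Lemma radix_rcons w x p : radix (rcons w (x, p)) = (radix w * p)%N.
Proof. by rewrite /radix -cats1 big_cat big_seq1. Qed.

Section Stage.
Variables (X : eqType) (f : gT -> X) (H K K' : {group gT}) (x : gT).
Variables (w : seq (gT * nat)) (k : nat) (qs qs' : seq gT).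
Hypotheses (hf : hides f H) (stepK : chain_step K K' x).
Hypothesis prog : progress f H K w k qs.
Hypothesis uqs' : uniq qs'.
Hypothesis qs'E : qs' =i qs ++ stage_queries w k x.

Let a := window k (radix w).

Let a_gt0 : (0 < a)%N.
Proof. exact/window_gt0/radix_gt0/(progress_radices prog). Qed.

Lemma stage_known : K :&: H \subset known (transcript f qs').
Proof.
apply: subset_trans (progress_known prog) _; rewrite gen_subG.
apply/subsetP => d; rewrite inE.
case/hasP=> _ /mapP[g gqs ->] /hasP[_ /mapP[g' g'qs ->]] /= /andP[/eqP e /eqP->].
apply: mem_known; rewrite ?qs'E ?mem_cat ?gqs ?g'qs //.
exact: eq_label e.
Qed.

(** At a pivot [x = z h] with [z] in [K] and [h] in [H]; factoring [z^-1], modulo [K :&: H], into a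
    baby and a giant step yields two queries that collide. *)
Lemma stage_collision : ~~ (K' :&: H \subset K) ->
  ~~ (K' :&: known (transcript f qs') \subset K).
Proof.
case: stepK => KK' pr /setDP[xK' xK] _ HnK.
have KH := prime_index_mulg KK' pr (subsetIl K' H) HnK.
have /mulsgP[z h zK /setIP[hK' hH] xE] : x \in K * (K' :&: H) by rewrite KH.
have [r [l [rw /setIP[lK lH] zE]]] := progress_cover prog (groupVr zK).
have [b [g [ba ga rE]]] := digits_baby_giant (progress_radices prog) a_gt0 rw.
(* [x g b = h l^-1] lies in [H], so [b] and [(x g)^-1] have the same label. *)
have dE : b^-1 * (x * g)^-1 = (h * l^-1)^-1.
  rewrite -invMg -mulgA (mulgC_abelian cG g) -rE; congr (_^-1).
  have -> : r = z^-1 * l^-1 by rewrite zE mulgK.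
  by rewrite mulgA xE (mulgC_abelian cG z) mulgK.
have dH : (h * l^-1)^-1 \in H by rewrite groupV groupM ?groupV.
apply/subsetPn; exists (h * l^-1)^-1.
  rewrite inE; apply/andP; split; last first.
    rewrite -dE; apply: mem_known; last by apply/(hidesE hf); rewrite dE.
      by rewrite qs'E !mem_cat ba orbT.
    by rewrite qs'E !mem_cat (map_f (fun b => (x * b)^-1) ga) !orbT.
  by rewrite groupV groupM ?groupV // (subsetP KK').
apply: contra xK; rewrite groupV groupMr ?groupV // => hK.
by rewrite xE groupM.
Qed.

(** The left side is computable from the transcript, so the algorithm can branch on the unknown
    right side. *)
Lemma stage_pivotE :
  (K' :&: known (transcript f qs') \subset K) = (K' :&: H \subset K).
Proof.
apply/idP/idP => [|le]; first exact: contraTT stage_collision.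
by apply: subset_trans le; rewrite setIS ?(known_sub _ hf).
Qed.

Lemma stage_cost w' k' :
    (forall b, giant_bound k (radix w) b ->
       Rle (Rplus (giant_cost k (radix w)) (INR b))
           (giant_cost k' (radix (w ++ w')))) ->
    (k <= k')%N -> positive_radices (w ++ w') ->
  exists2 S : seq gT,
    {subset qs' <= baby (w ++ w') (window k' (radix (w ++ w'))) ++ S} &
    Rle (INR (size S)) (giant_cost k' (radix (w ++ w'))).
Proof.
move=> cost kk' pos; have [S qsS sizeS] := progress_cost prog.
have posw := progress_radices prog.
have sub : {subset baby w a <= baby (w ++ w') (window k' (radix (w ++ w')))}.
  apply: baby_mono => //; rewrite a_gt0 window_mono //.
  rewrite /radix big_cat /= leq_pmulr //; apply: radix_gt0.
  by move: pos; rewrite /positive_radices all_cat => /andP[].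
exists (S ++ [seq (x * b)^-1 | b <- giant w a]).
  move=> y; rewrite qs'E !mem_cat => /or3P[/qsS | /sub -> // | ->].
  - by rewrite mem_cat => /orP[/sub -> // | ->]; rewrite ?orbT.
  - by rewrite !orbT.
rewrite size_cat size_map -plusE plus_INR.
apply: Rle_trans (Rplus_le_compat_r _ _ _ sizeS) _.
by apply: cost; apply: size_giant.
Qed.

Lemma stage_pivot : ~~ (K' :&: H \subset K) -> progress f H K' w k.+1 qs'.
Proof.
case: (stepK) => KK' pr /setDP[xK' xK] _ HnK.
have KH := prime_index_mulg KK' pr (subsetIl K' H) HnK.
have KI : K :&: (K' :&: H) = K :&: H by rewrite setIA (setIidPl KK').
have posw := progress_radices prog.
split=> //.
- move=> y; rewrite -[in y \in _]KH => /mulsgP[z h zK hK' ->].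
  have [r [l [rw /setIP[lK lH] ->]]] := progress_cover prog zK.
  exists r, (l * h); rewrite mulgA; split=> //.
  by rewrite groupM // inE lH (subsetP KK').
(* Product formula: [|K| |K' :&: H| = |K'| |K :&: H|]. *)
- have card := mul_cardG K (K' :&: H)%G; rewrite /= KH KI in card.
  rewrite -(leq_pmul2l (cardG_gt0 K)) mulnCA card mulnCA [leqRHS]mulnC leq_mul2l.
  by rewrite (progress_radix prog) orbT.
- have sub : K :&: H \proper K' :&: H.
    rewrite properE setSI //=; apply: contra HnK => le.
    by apply: subset_trans le (subsetIl _ _).
  rewrite expnS.
  have /dvdnP[q qE] : #|K :&: H| %| #|K' :&: H| by rewrite cardSg ?proper_sub.
  move: (proper_card sub); rewrite qE.
  case: q {qE} => [|[|q]] //; rewrite ?mul1n ?ltnn // => _.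
  by rewrite leq_mul ?(progress_pivots prog).
(* Known elements outside [K] also fill [K'] over [K]: so [y = z d] with [d] known, and then [z]
   lies in [K :&: H], which is already known. *)
- have nK : ~~ (K' :&: known (transcript f qs') \subset K) by rewrite stage_pivotE.
  rewrite -(prime_index_mulg KK' pr (subsetIl _ _) nK).
  apply/subsetP => y /setIP[/mulsgP[z d zK /setIP[_ dknown] ->] yH].
  have dH : d \in H by apply: subsetP dknown; apply: known_sub.
  rewrite groupMr // in yH.
  by rewrite groupM // (subsetP stage_known) // inE zK.
- have [|||S] := @stage_cost [::] k.+1; rewrite ?cats0 //; last by exists S.
  by move=> b; apply: giant_cost_pivot; apply: radix_gt0.
Qed.

(** [K' :&: H] equals [K :&: H], so the powers of [x] are a new digit; appending makes it the most
    significant one, as [baby_mono] requires. *)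
Lemma stage_digit : K' :&: H \subset K ->
  progress f H K' (rcons w (x, #|K' : K|)) k qs'.
Proof.
case: (stepK) => KK' pr _ dig HK.
have HE : K' :&: H = K :&: H.
  by apply/eqP; rewrite eqEsubset subsetI HK subsetIr setSI.
have posw := progress_radices prog.
have pos : positive_radices (rcons w (x, #|K' : K|)).
  by rewrite /positive_radices all_rcons /= prime_gt0.
split=> //; rewrite ?HE.
- move=> y /dig[z [c [zK cp ->]]].
  have [r [l [rw lKH ->]]] := progress_cover prog zK.
  exists (r * x ^+ c), l; split=> //; first exact: digits_rcons.
  by rewrite -!mulgA (mulgC_abelian cG l).
- rewrite radix_rcons -(Lagrange KK') mulnAC leq_mul2r.
  by rewrite (progress_radix prog) orbT.
- exact: progress_pivots prog.
- exact: stage_known.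
- have [|||S] := @stage_cost [:: (x, #|K' : K|)] k; rewrite ?cats1 //; last by exists S.
  move=> b; rewrite radix_rcons; apply: giant_cost_radix; first exact: radix_gt0.
  exact: prime_gt1.
Qed.

End Stage.

(** The tree is built before [f] is given: the next stage depends only on which earlier ones were
    pivots, so each outcome gets its own subtree. [stop] ends the climb at the first pivot. *)
Lemma search (O : Type) (out : {set gT} -> O) (stop : bool) K w k :
    (stop ==> (k <= 1))%N ->
  exists t : seq (gT * nat) -> tree gT O,
  forall (X : eqType) (f : gT -> X) H qs,
    hides f H -> progress f H K w k qs ->
  exists K' w' k', [/\ progress f H K' w' k' (eval f (t (transcript f qs)) qs).2,
    (eval f (t (transcript f qs)) qs).1
      = out (known (transcript f (eval f (t (transcript f qs)) qs).2)) &
    (stop ==> (k' <= 1))%N && ((stop && (0 < k')%N) || (K' == [set: gT] :> {set gT}))].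
Proof.
have [n] := ubnP #|~: K|; elim: n K w k => // n IHn K w k leKn k1.
have [fin | go] := boolP ((stop && (0 < k)%N) || (K == [set: gT] :> {set gT})).
  exists (fun hist => Leaf (out (known hist))) => X f H qs hf prog.
  by exists K, w, k; split; rewrite ?k1.
move: go; rewrite negb_or => /andP[go KnT].
have k1' : (stop ==> (k.+1 <= 1))%N.
  by case: stop go {k1 IHn} => //=; rewrite -leqNgt.
have [K' [x step]] := chain_stepP KnT.
have [KK' pr /setDP[xK' xK] _] := step.
have ltn : (#|~: K'| < n)%N.
  rewrite -ltnS; apply: leq_trans leKn; rewrite ltnS.
  apply: proper_card; rewrite properE !setCS KK' /=.
  by apply/subsetPn; exists x.
have [t1 t1P] := IHn K' w k.+1 ltn k1'.
have [t2 t2P] := IHn K' (rcons w (x, #|K' : K|)) k ltn k1.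
exists (ask_new (stage_queries w k x) (fun hist =>
  if K' :&: known hist \subset K then t2 hist else t1 hist)) => X f H qs hf prog.
have [qs' [uqs' qs'E ->]] := eval_ask_new f (stage_queries w k x)
  (fun hist => if K' :&: known hist \subset K then t2 hist else t1 hist)
  (progress_uniq prog).
rewrite (stage_pivotE hf step prog qs'E).
have [HK | HnK] := boolP (K' :&: H \subset K).
  exact: t2P _ _ _ _ hf (stage_digit step prog uqs' qs'E HK).
exact: t1P _ _ _ _ hf (stage_pivot hf step prog uqs' qs'E HnK).
Qed.

Lemma progress_start (X : eqType) (f : gT -> X) H : progress f H 1%G [::] 0 [::].
Proof.
have I1 : 1%G :&: H = 1 by apply/setIidPl; apply: sub1G.
split; rewrite /= ?I1 ?cards1 //.
- by move=> y /set1P->; exists 1, 1; rewrite mulg1 !inE.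
- by rewrite /radix big_nil.
- by apply: sub1G.
- by exists [::] => //; apply: giant_cost_ge0.
Qed.

Lemma progress_size (X : eqType) (f : gT -> X) H K w k qs :
  progress f H K w k qs ->
  Rle (INR (size qs)) (query_cost k (radix w)).
Proof.
move=> prog; have [S sub le] := progress_cost prog.
have posw := progress_radices prog.
have a0 : (0 < window k (radix w))%N by apply/window_gt0/radix_gt0.
apply: Rle_trans (INR_le (uniq_leq_size (progress_uniq prog) sub)) _.
rewrite size_cat -plusE plus_INR.
apply: Rle_trans (Rplus_le_compat _ _ _ _ (INR_le (size_baby w a0)) le) _.
by have := window_le k (radix w); rewrite /giant_cost /query_cost; lra.
Qed.

(** [|K| / |K :&: H| = |K H| / |H|], at most [|G| / |H|]. *)
Lemma progress_index (X : eqType) (f : gT -> X) H K w k qs :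
  progress f H K w k qs -> Rle (INR (radix w)) (Rdiv (INR #|[set: gT]|) (INR #|H|)).
Proof.
move=> prog.
have H0 : Rlt 0 (INR #|H|).
  by apply: Rlt_le_trans (INR_ge1 (cardG_gt0 H)); apply: Rlt_0_1.
apply: (Rmult_le_reg_r (INR #|H|)) => //.
rewrite /Rdiv Rmult_assoc Rinv_l; last by lra.
rewrite Rmult_1_r -INR_muln; apply: INR_le.
rewrite -(leq_pmul2r (cardG_gt0 (K :&: H)%G)) mulnAC.
apply: leq_trans (leq_mul (progress_radix prog) (leqnn _)) _.
by rewrite mul_cardG leq_mul2r subset_leq_card ?orbT ?subsetT.
Qed.

Lemma progress_known_full (X : eqType) (f : gT -> X) H K w k qs :
  hides f H -> progress f H K w k qs -> K = [set: gT] :> {set gT} ->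
  known (transcript f qs) = H :> {set gT}.
Proof.
move=> hf prog KT; apply/eqP; rewrite eqEsubset known_sub //=.
by have := progress_known prog; rewrite KT setTI.
Qed.

(** After a pivot [K :&: H] is known and has at least two elements, so both sides are false;
    otherwise the climb is complete and [known] gives [H]. *)
Lemma progress_known_trivial (X : eqType) (f : gT -> X) H K w k qs :
    hides f H -> progress f H K w k qs ->
    (0 < k)%N || (K == [set: gT] :> {set gT}) ->
  (known (transcript f qs) :==: 1) = (H :==: 1).
Proof.
move=> hf prog /orP[k0 | /eqP KT]; last by rewrite (progress_known_full hf prog KT).
have known1 : ~~ (known (transcript f qs) \subset [1]).
  apply: contraTN (progress_pivots prog) => sub1; rewrite -ltnNge.
  have := subset_leq_card (subset_trans (progress_known prog) sub1).
  by rewrite cards1 => /leq_ltn_trans-> //; rewrite -(expn0 2) ltn_exp2l.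
have H1 : ~~ (H \subset [1]).
  by apply: contra known1; apply: subset_trans (known_sub _ hf).
by rewrite -!subG1 (negbTE known1) (negbTE H1).
Qed.

End Search.

Theorem theorem2 :
  exists C : R, Rlt 0 C /\
  forall (gT : finGroupType), abelian [set: gT] ->
    (exists A : algorithm gT bool,
       forall (X : finType) (f : gT -> X) (H : {group gT}),
         hides f H ->
         exists q : nat,
           runs_to A f (H :==: 1%g) q /\
           Rle (INR q) (decision_bound C #|[set: gT]| #|H|)) /\
    (exists A : algorithm gT {set gT},
       forall (X : finType) (f : gT -> X) (H : {group gT}),
         hides f H ->
         exists q : nat,
           runs_to A f (H : {set gT}) q /\
           Rle (INR q) (identification_bound C #|[set: gT]| #|H|)).
Proof.
exists (IZR 30); split; first lra.
move=> gT cG; split.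
- have [t tP] := @search _ cG _ (fun D : {set gT} => D == 1%g) true 1%G [::] 0 isT.
  exists (tree_alg (t [::])) => X f H hf.
  have [K [w [k [prog DE /andP[k1 fin]]]]] :=
    tP X f H [::] hf (progress_start f H).
  exists (size (eval f (t [::]) [::]).2); split.
    by rewrite -(progress_known_trivial hf prog fin) -DE; apply: runs_to_tree_alg.
  apply: Rle_trans (progress_size prog) _.
  apply: query_cost_decision (progress_index prog) => //.
  exact: radix_gt0 (progress_radices prog).
- have [t tP] := @search _ cG _ id false 1%G [::] 0 isT.
  exists (tree_alg (t [::])) => X f H hf.
  have [K [w [k [prog DE /eqP KT]]]] := tP X f H [::] hf (progress_start f H).
  exists (size (eval f (t [::]) [::]).2); split.
    by rewrite -(progress_known_full hf prog KT) -DE; apply: runs_to_tree_alg.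
  apply: Rle_trans (progress_size prog) _.
  apply: query_cost_identification (progress_index prog).
    apply: leq_trans (progress_pivots prog) _.
    by rewrite subset_leq_card ?subsetIr.
  exact: radix_gt0 (progress_radices prog).
Qed.
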